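(* Let $K$ be a computable field, $K'$ an algebraically closed extension of $K$, and $K[\overline{a}]=K[a_1,\dots,a_m]$. For an ideal $J\subset K[\overline a]$ let $\mathbb V(J)\subset {K'}^m$ denote its zero set in ${K'}^m$. 1. Every set $C=\mathbb V(N)\setminus\mathbb V(M)\subset {K'}^m$ corresponding to a diff-specification $(N,M)$ admits a can-specification, and the algorithm DIFFTOCANSPEC builds it. 2. Over ${K'}^m$, a can-specification $(N_i,M_{ij})$ of $C$, with $\mathcal N=\bigcap_i N_i$, verifies $$\overline{C}=\overline{\bigcup_i\Big(\mathbb V(N_i)\setminus\Big(\bigcup_j\mathbb V(M_{ij})\Big)\Big)}=\bigcup_i\mathbb V(N_i)=\mathbb V(\mathcal N).$$ 3. The can-specification associated to a set $C$ given by a diff-specification is unique. 4. For the can-specification $(N_i,M_{ij})$ of $C$, all points in $C\cap\mathbb V(N_i)$ are in $\mathbb V(N_i)\setminus\big(\bigcup_j\mathbb V(M_{ij})\big)$.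
   Context: Varieties: for an ideal $J$ of $K[\overline a]=K[a_1,\dots,a_m]$, $\mathbb V(J)=\{\overline a\in {K'}^m : f(\overline a)=0 \text{ for all } f\in J\}$; that is, ideals are defined over the base field $K$ but zero sets are taken in ${K'}^m$. The bar denotes Zariski closure in ${K'}^m$. Diff-specification: two ideals $N\subset M$ of $K[\overline a]$, whose associated varieties verify $\mathbb V(N)\supset\mathbb V(M)$, define a diff-specification $(N,M)$ describing the subset $\mathbb V(N)\setminus\mathbb V(M)$ of ${K'}^m$. Can-specification: a can-specification of a subset $C$ is a representation defined by the set of prime ideals $(N_i,M_{ij})$ of $K[\overline a]$, varying $i,j$, such that $$C=\mathbb V(N)\setminus\mathbb V(M)=\bigcup_i\Big(\mathbb V(N_i)\setminus\Big(\bigcup_j\mathbb V(M_{ij})\Big)\Big),$$ where $\mathcal N=\bigcap_i N_i$ and $\mathcal M_i=\bigcap_j M_{ij}$ are the prime decompositions over $K[\overline a]$ of the radical ideals $\mathcal N$ and $\mathcal M_i$ respectively, and where $N_i\subsetneq M_{ij}$. PRIMEDECOMP$(J)$: returns the set of irredundant prime ideals over $K$ in the decomposition of $\sqrt J$ as an intersection of primes of $K[\overline a]$ (if $\sqrt J=\langle 1\rangle$ there are no primes, and nothing is subtracted). Algorithm DIFFTOCANSPEC$(N,M)$: start with $Y=\emptyset$; for each $N_j\in$ PRIMEDECOMP$(N)$ with $N_j\neq\sqrt{M+N_j}$, compute $T_j=$ PRIMEDECOMP$(M+N_j)$ and add the pair $(N_j,T_j)$ to $Y$. The output is $Y$.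
   Formalization: In items 3 and 4 the can-specification is also required to satisfy ⋂_j M_ij = √(M+N_i) for some diff-specification (N,M) of C, as the algorithm's output does; without this both fail, e.g. for C = V(xy) with {((x),{(x,y)}), ((y),∅)}. *)

(* Defs.v *)
From mathcomp Require Import all_boot all_order all_algebra.
From mathcomp Require Import mpoly.
From mathcomp Require Import boolp classical_sets cardinality.

Set Implicit Arguments.
Unset Strict Implicit.
Unset Printing Implicit Defensive.

Import GRing.Theory.
Local Open Scope ring_scope.
Local Open Scope classical_set_scope.

Section Ideals.
Variable R : comNzRingType.
Implicit Types (J P : set R) (s : seq R).

(* The unit ideal is allowed, whereas idealr_closed of ring_quotient only
   describes proper ideals. *)
Definition is_ideal J : Prop :=
  J 0 /\ forall a u v, J u -> J v -> J (a * u + v).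

Definition is_prime_ideal P : Prop :=
  idealr_closed (fun f => f \in P) /\ prime_idealr_closed (fun f => f \in P).

Definition radical J : set R := [set f | exists n : nat, J (f ^+ n)].

Definition ideal_add J1 J2 : set R := [set f1 + f2 | f1 in J1 & f2 in J2].

Definition ideal_gen s : set R := smallest is_ideal [set` s].

(* J = \bigcap_(i in D) P i is a finite irredundant intersection of primes;
   no index can be dropped, so P is injective on D.  The empty intersection is
   the whole ring, so the unit ideal is decomposed by D = set0 only. *)
Definition prime_decomposition (I : Type) (D : set I) (P : I -> set R) J :=
  [/\ finite_set D,
      forall i, D i -> is_prime_ideal (P i),
      J = \bigcap_(i in D) P i
    & forall i, D i -> \bigcap_(j in D `\ i) P j <> J].

End Ideals.

Section Varieties.
Variables (K : fieldType) (K' : closedFieldType) (iota : {rmorphism K -> K'}).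
Variable m : nat.

Local Notation poly := {mpoly K[m]}.
Local Notation point := ('I_m -> K').

Definition zeros (F : set {mpoly K'[m]}) : set point :=
  [set x | forall f, F f -> f.@[x] = 0].

(* The ideal lives over K, its zero set over K'. *)
Definition variety (J : set poly) : set point :=
  zeros [set map_mpoly iota f | f in J].

Definition zariski_closed (S : set point) : Prop :=
  exists F : set {mpoly K'[m]}, S = zeros F.

Definition zariski_closure (S : set point) : set point :=
  smallest zariski_closed S.

Definition diff_spec (N M : set poly) : Prop :=
  [/\ is_ideal N, is_ideal M, N `<=` M & variety M `<=` variety N].

Definition diff_set (N M : set poly) : set point := variety N `\` variety M.

(* The family (N_i, M_ij) is the set of the pairs (N_i, {M_ij}_j); such a p has
   N_i = p.1 and {M_ij}_j = p.2. *)
Definition spec_family : Type := set (set poly * set (set poly)).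

Definition component (p : set poly * set (set poly)) : set point :=
  variety p.1 `\` \bigcup_(P in p.2) variety P.

Definition can_spec (C : set point) (Y : spec_family) : Prop :=
  [/\ exists N M, diff_spec N M /\ C = diff_set N M,
      C = \bigcup_(p in Y) component p,
      prime_decomposition Y fst (\bigcap_(p in Y) p.1),
      forall p, Y p -> prime_decomposition p.2 id (\bigcap_(P in p.2) P)
    & forall p, Y p -> forall P, p.2 P -> p.1 `<` P].

(* In can_spec the radical ideals M_i = \bigcap_j M_ij are constrained only
   through the union, which does not determine the family: V(xy) is both
   V(x) U V(y) and (V(x) \ V(x, y)) U V(y).  The can-specification associated
   to a set given by a diff-specification (N, M) is the one in which M_i is the
   radical of M + N_i, i.e. in which V(N_i) \ V(M) is the i-th component. *)
Definition assoc_can_spec (C : set point) (Y : spec_family) : Prop :=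
  can_spec C Y /\
  exists N M, [/\ diff_spec N M, C = diff_set N M
    & forall p, Y p -> \bigcap_(P in p.2) P = radical (ideal_add M p.1)].

End Varieties.

Section Algorithm.
Variables (K : fieldType) (m : nat).

Local Notation poly := {mpoly K[m]}.

(* In the algorithm ideals are given by finite lists of generators.  What is
   used of the computability of K is a subroutine primedecomp for prime
   decomposition over K, and a test eq_radical of equality of an ideal with the
   radical of another one. *)
Definition primedecomp_spec (primedecomp : seq poly -> seq (seq poly)) : Prop :=
  forall s, prime_decomposition [set` primedecomp s] (@ideal_gen poly)
                                (radical (ideal_gen s)).

Definition eq_radical_spec (eq_radical : seq poly -> seq poly -> bool) : Prop :=
  forall s t, eq_radical s t <-> ideal_gen s = radical (ideal_gen t).

(* M ++ Nj generates the sum of the ideals. *)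
Definition diff_to_can_spec (primedecomp : seq poly -> seq (seq poly))
    (eq_radical : seq poly -> seq poly -> bool) (N M : seq poly) :
    seq (seq poly * seq (seq poly)) :=
  foldl (fun Y Nj => if eq_radical Nj (M ++ Nj) then Y
                     else rcons Y (Nj, primedecomp (M ++ Nj)))
        [::] (primedecomp N).

Definition output_family (Y : seq (seq poly * seq (seq poly))) :
    spec_family K m :=
  [set (ideal_gen q.1, [set ideal_gen t | t in [set` q.2]]) | q in [set` Y]].

End Algorithm.

(* Main.v *)
(* The vanishing ideal over K of the closure of C is the intersection of the N_i,
   so C determines the N_i as its minimal primes; and when the intersection of the
   M_ij is rad(M + N_i), it is the vanishing ideal of V(N_i) \ C, so C determines
   the M_ij as well.  That V(N_i) minus the V(M_ij) is dense in V(N_i) over K',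
   although V(N_i) may be reducible over K', comes from flatness: an f in K[a]
   outside the prime N_i is still a nonzerodivisor modulo N_i K'[a], so if g f
   vanishes on V(N_i), a power of g lies in N_i K'[a].
   The Nullstellensatz is proved one variable at a time: a point of a prime P of
   R[X] avoiding f is obtained by evaluating R at a point avoiding finitely many
   coefficients and then choosing a root of a polynomial of P. *)

Require Import Defs.
From HB Require Import structures.
From mathcomp Require Import all_boot all_order all_algebra.
From mathcomp Require Import mpoly.
From mathcomp Require Import boolp classical_sets cardinality.

Set Implicit Arguments.
Unset Strict Implicit.
Unset Printing Implicit Defensive.

Import GRing.Theory.
Local Open Scope ring_scope.
Local Open Scope classical_set_scope.

(** * Ideals and prime decompositions *)

Section IdealTheory.
Variable R : comNzRingType.
Implicit Types (J P Q N M : set R) (s t : seq R).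

Lemma ideal0 J : is_ideal J -> J 0.
Proof. by case. Qed.

Lemma idealMl J u v : is_ideal J -> J v -> J (u * v).
Proof. by move=> [J0 JM] Jv; rewrite -[_ * _]addr0; apply: JM. Qed.

Lemma idealD J u v : is_ideal J -> J u -> J v -> J (u + v).
Proof. by move=> [_ JM] Ju Jv; rewrite -[u]mul1r; apply: JM. Qed.

Lemma idealB J u v : is_ideal J -> J u -> J v -> J (u - v).
Proof.
by move=> JI Ju Jv; apply: idealD => //; rewrite -mulN1r; apply: idealMl.
Qed.

Lemma ideal_sum J (I : Type) (r : seq I) (p : pred I) (F : I -> R) :
  is_ideal J -> (forall i, p i -> J (F i)) -> J (\sum_(i <- r | p i) F i).
Proof.
move=> JI JF; apply: big_ind => //; first exact: ideal0.
by move=> x y; apply: idealD.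
Qed.

Lemma is_ideal_bigcap (I : Type) (D : set I) (F : I -> set R) :
  (forall i, D i -> is_ideal (F i)) -> is_ideal (\bigcap_(i in D) F i).
Proof.
move=> FI; split=> [i Di|a u v Fu Fv i Di]; first exact: ideal0 (FI i Di).
by apply: idealD (FI _ Di) _ (Fv _ Di); apply: idealMl (FI _ Di) (Fu _ Di).
Qed.

Lemma is_ideal_add J1 J2 : is_ideal J1 -> is_ideal J2 -> is_ideal (ideal_add J1 J2).
Proof.
move=> I1 I2; split.
  by exists 0; [exact: ideal0|exists 0; [exact: ideal0|exact: addr0]].
move=> a _ _ [u Ju [v Jv <-]] [u' Ju' [v' Jv' <-]].
exists (a * u + u'); first by case: I1 => _; apply.
by exists (a * v + v'); [case: I2 => _; apply|rewrite mulrDr addrACA].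
Qed.

Lemma ideal_addl J1 J2 : is_ideal J2 -> J1 `<=` ideal_add J1 J2.
Proof. by move=> I2 u Ju; exists u => //; exists 0; [exact: ideal0|exact: addr0]. Qed.

Lemma ideal_addr J1 J2 : is_ideal J1 -> J2 `<=` ideal_add J1 J2.
Proof. by move=> I1 u Ju; exists 0; [exact: ideal0|exists u => //; exact: add0r]. Qed.

Lemma ideal_add_sub J1 J2 J : is_ideal J -> J1 `<=` J -> J2 `<=` J ->
  ideal_add J1 J2 `<=` J.
Proof. by move=> JI s1 s2 _ [u /s1 Ju [v /s2 Jv <-]]; apply: idealD. Qed.

Lemma is_ideal_gen s : is_ideal (ideal_gen s).
Proof. by rewrite /ideal_gen /smallest; apply: is_ideal_bigcap => J []. Qed.

Lemma ideal_gen_mem s x : x \in s -> ideal_gen s x.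
Proof. by move=> xs; apply: (@sub_gen_smallest _ (@is_ideal R) [set` s]). Qed.

Lemma ideal_gen_sub s J : is_ideal J -> (forall x, x \in s -> J x) ->
  ideal_gen s `<=` J.
Proof. by move=> JI sJ; apply: smallest_sub. Qed.

Lemma ideal_gen_cat s t : ideal_gen (s ++ t) = ideal_add (ideal_gen s) (ideal_gen t).
Proof.
have [sI tI] := (is_ideal_gen s, is_ideal_gen t).
apply/seteqP; split.
  apply: ideal_gen_sub; first exact: is_ideal_add.
  move=> x; rewrite mem_cat => /orP[] /ideal_gen_mem; first exact: ideal_addl.
  exact: ideal_addr.
have cI := is_ideal_gen (s ++ t).
by apply: ideal_add_sub => //; apply: ideal_gen_sub => // x xs;
  apply: ideal_gen_mem; rewrite mem_cat xs ?orbT.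
Qed.

Lemma sub_radical J : J `<=` radical J.
Proof. by move=> u Ju; exists 1. Qed.

(** In the binomial expansion of a power [n + k], each term contains [v ^+ k] or [u ^+ n]. *)
Lemma is_ideal_radical J : is_ideal J -> is_ideal (radical J).
Proof.
move=> JI; split; first by exists 1; rewrite expr1; exact: ideal0.
move=> a u v [n Jun] [k Jvk]; exists (n + k)%N.
rewrite exprDn; apply: ideal_sum => // -[i ik] /= _.
rewrite -mulr_natl; apply: idealMl => //.
have [kn|nk] := leqP k i.
  by apply: idealMl => //; rewrite -(subnK kn) exprD; apply: idealMl.
rewrite mulrC; apply: idealMl => //; rewrite exprMn; apply: idealMl => //.
have ni : (n <= n + k - i)%N by rewrite -addnBA ?leq_addr // ltnW.
by rewrite -(subnK ni) exprD; apply: idealMl.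
Qed.

Lemma radical_sub_radical J1 J2 : J1 `<=` radical J2 -> radical J1 `<=` radical J2.
Proof. by move=> s u [n /s[k]]; rewrite -exprM; exists (n * k)%N. Qed.

Lemma prime_idealI P : is_prime_ideal P -> is_ideal P.
Proof.
move=> [[P0 _ PM] _]; split=> [|a u v Pu Pv]; first exact: set_mem.
by apply: set_mem; apply: PM; apply: mem_set.
Qed.

Lemma prime_ideal1 P : is_prime_ideal P -> ~ P 1.
Proof. by move=> [[_ /negP P1 _] _] /mem_set. Qed.

Lemma prime_idealM P u v : is_prime_ideal P -> P (u * v) -> P u \/ P v.
Proof.
by move=> [_ PM] /mem_set /PM /orP[] /set_mem; [left|right].
Qed.

Lemma prime_idealX P u n : is_prime_ideal P -> P (u ^+ n) -> P u.
Proof.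
move=> Pp; elim: n => [/(prime_ideal1 Pp)//|n IH].
by rewrite exprS => /(prime_idealM Pp)[//|/IH].
Qed.

Lemma is_prime_idealP P : is_ideal P -> ~ P 1 ->
  (forall u v, P (u * v) -> P u \/ P v) -> is_prime_ideal P.
Proof.
move=> PI P1 PM; split; first split.
- by apply: (@mem_set _ P); apply: ideal0.
- by apply/negP => /(@set_mem _ P).
- move=> a u v /(@set_mem _ P) Pu /(@set_mem _ P) Pv; apply: (@mem_set _ P).
  by case: PI => _; apply.
- by move=> u v /(@set_mem _ P) /PM[] Pu; apply/orP; [left|right]; apply: (@mem_set _ P).
Qed.

Lemma radical_bigcap_primes (I : Type) (D : set I) (F : I -> set R) J :
  (forall i, D i -> is_prime_ideal (F i)) -> J = \bigcap_(i in D) F i ->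
  radical J = J.
Proof.
move=> Fp ->; apply/seteqP; split; last exact: sub_radical.
by move=> u [n un] i Di; apply: (prime_idealX (Fp i Di)) (un i Di).
Qed.

(* The common element is a product of one element of each ideal. *)
Lemma bigcap_ideal_meets (I : Type) (D : set I) (F : I -> set R) (S : set R) :
  finite_set D -> (forall i, D i -> is_ideal (F i)) ->
  S 1 -> (forall u v, S u -> S v -> S (u * v)) ->
  (forall i, D i -> exists2 f, F i f & S f) ->
  exists2 f, (\bigcap_(i in D) F i) f & S f.
Proof.
move=> /(@finite_seqP {classic I})[s ->] FI S1 SM FS.
elim: s FI FS => [|i s IH] FI FS; first by exists 1 => // i.
have [|j js|f fF Sf] := IH.
- by move=> j js; apply: FI; rewrite /= inE js orbT.
- by apply: FS; rewrite /= inE js orbT.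
have [|g gF Sg] := FS i; first by rewrite /= inE eqxx.
exists (f * g); last exact: SM.
move=> j /=; rewrite inE => /orP[/eqP->|js].
  by apply: idealMl => //; apply: FI; rewrite /= inE eqxx.
rewrite mulrC; apply: idealMl; last exact: fF.
by apply: FI; rewrite /= inE js orbT.
Qed.

(** Otherwise each [F i] has an element outside [P], and since the complement of [P] is closed under
    products, the intersection would have one too. *)
Lemma bigcap_sub_prime (I : Type) (D : set I) (F : I -> set R) P :
  finite_set D -> (forall i, D i -> is_ideal (F i)) -> is_prime_ideal P ->
  \bigcap_(i in D) F i `<=` P -> exists2 i, D i & F i `<=` P.
Proof.
move=> Dfin FI Pp sP; apply: contrapT => none.
have [||i Di|f /sP Pf] := @bigcap_ideal_meets I D F (~` P) Dfin FI => //.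
- exact: prime_ideal1.
- by move=> u v Pu Pv /(prime_idealM Pp)[].
- apply: contrapT => sub; apply: none; exists i => // f Ff.
  by apply: contrapT => Pf; apply: sub; exists f.
Qed.

(** Refers to [J] alone and to no decomposition; identifying the components of a decomposition with
    these primes is what makes them unique. *)
Definition minimal_prime J : set (set R) :=
  [set P | [/\ is_prime_ideal P, J `<=` P &
    forall Q, is_prime_ideal Q -> J `<=` Q -> Q `<=` P -> Q = P]].

Section Decomposition.
Variables (I : Type) (D : set I) (F : I -> set R) (J : set R).
Hypothesis DF : prime_decomposition D F J.

(** If [j] were another index, [F i] could be dropped without changing the intersection, against
    irredundancy. *)
Lemma prime_decomposition_sub i j : D i -> D j -> F j `<=` F i -> j = i.
Proof.
case: DF => _ _ JE irr Di Dj sF; apply: contrapT => ji; apply: (irr i Di).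
rewrite JE; apply/seteqP; split=> f fF k Dk; last by apply: fF; case: Dk.
have [->|ki] := EM (k = i); last by apply: fF.
by apply/sF/fF.
Qed.

Lemma prime_decomposition_inj i j : D i -> D j -> F i = F j -> i = j.
Proof.
by move=> Di Dj FE; apply: prime_decomposition_sub => //; rewrite FE.
Qed.

(** Any prime above [J] contains some [F i], and no [F i] contains another. *)
Lemma prime_decomposition_minimal : F @` D = minimal_prime J.
Proof.
case: (DF) => Dfin Fp JE irr.
have FI i : D i -> is_ideal (F i) by move=> /Fp /prime_idealI.
have below Q : is_prime_ideal Q -> J `<=` Q -> exists2 i, D i & F i `<=` Q.
  by rewrite JE; exact: bigcap_sub_prime.
have above i : D i -> J `<=` F i by rewrite JE => Di f; apply.
apply/seteqP; split=> [_ [i Di <-]|P [Pp JP Pmin]].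
  split; [exact: Fp|exact: above|] => Q Qp JQ QF.
  have [j Dj FQ] := below Q Qp JQ.
  have ji := prime_decomposition_sub Di Dj (subset_trans FQ QF).
  by apply/seteqP; split=> //; rewrite -ji.
have [i Di FP] := below P Pp JP; exists i => //.
by apply: Pmin => //; [exact: Fp|exact: above].
Qed.

(** Turns a decomposition indexed by lists of generators into one indexed by the ideals themselves;
    injectivity of [F] on [D] keeps it irredundant. *)
Lemma prime_decomposition_image : prime_decomposition (F @` D) id J.
Proof.
case: (DF) => Dfin Fp JE irr; split.
- exact: finite_image.
- by move=> _ [i Di <-]; apply: Fp.
- rewrite JE; apply/seteqP; split=> [f fF _ [i Di <-]|f fF i Di]; first exact: fF.
  by apply: (fF (F i)); exists i.
- move=> _ [i Di <-] E; apply: (irr i Di); rewrite -E.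
  apply/seteqP; split=> f fF.
    move=> _ [[j Dj <-] ji]; apply: fF; split => // ij; apply: ji.
    by rewrite ij.
  move=> j [Dj ji]; apply: (fF (F j)); split; first by exists j.
  by move=> /= FE; apply: ji; apply: prime_decomposition_inj.
Qed.

Lemma prime_decomposition_subset (D' : set I) : D' `<=` D ->
  prime_decomposition D' F (\bigcap_(i in D') F i).
Proof.
case: (DF) => Dfin Fp JE irr D'D; split=> //.
- exact: sub_finite_set Dfin.
- by move=> i /D'D; apply: Fp.
- move=> i D'i E; apply: (irr i (D'D i D'i)).
  rewrite JE; apply/seteqP; split=> f fF k Dk; last by apply: fF; case: Dk.
  have [ki|ki] := EM (k = i); last by apply: fF.
  have : (\bigcap_(j in D' `\ i) F j) f.
    by move=> j [D'j ji]; apply: fF; split => //; apply: D'D.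
  by rewrite E; apply; rewrite ki.
Qed.

End Decomposition.

(** * Noetherian rings *)

Definition noetherian : Prop :=
  forall J : set R, is_ideal J -> exists s, J = ideal_gen s.

(** Zorn's lemma gives a maximal counterexample: the union of a chain of ideals is finitely
    generated, hence equal to a member of the chain. *)
Lemma noetherian_ind (Q : set R -> Prop) : noetherian ->
  (forall J, is_ideal J ->
     (forall J', is_ideal J' -> J `<` J' -> Q J') -> Q J) ->
  forall J, is_ideal J -> Q J.
Proof.
move=> noeth step J JI; apply: contrapT => QJ.
pose bad := [set J' : set R | J' = set0 \/ is_ideal J' /\ ~ Q J'].
have [|A [Abad Amax]] := @Zorn_bigcup R bad.
  move=> F Fbad Ftot.
  have [F0|[X0 FX0 [x0 X0x]]] :
      (forall X, F X -> X = set0) \/ (exists2 X, F X & X !=set0).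
  - have [|none] := EM (exists2 X, F X & X !=set0); first by right.
    left=> X FX; apply/eqP; apply: contrapT => /negP/set0P ne.
    by apply: none; exists X.
  - by left; apply/seteqP; split=> // x [X /F0 ->].
  have ideal_of X x : F X -> X x -> is_ideal X /\ ~ Q X.
    by move=> /Fbad[->|].
  have UI : is_ideal (\bigcup_(X in F) X).
    split; first by exists X0 => //; apply: ideal0; have [] := ideal_of _ _ FX0 X0x.
    move=> a u v [X FX Xu] [Y FY Yv].
    have [XI _] := ideal_of _ _ FX Xu; have [YI _] := ideal_of _ _ FY Yv.
    have [XY|YX] := Ftot _ _ FX FY.
      by exists Y => //; case: YI => _; apply=> //; apply: XY.
    by exists X => //; case: XI => _; apply=> //; apply: YX.
  have [s Us] := noeth _ UI.
  (* The finitely many generators of the union lie in a single member of the chain, chosen nonempty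
     so that it is an ideal. *)
  have [X FX [x Xx sX]] : exists2 X, F X & exists2 x, X x & forall y, y \in s -> X y.
    have : forall y, y \in s -> (\bigcup_(X in F) X) y.
      by move=> y ys; rewrite Us; apply: ideal_gen_mem.
    elim: s {Us} => [|y s IH] sU; first by exists X0 => //; exists x0.
    have [|X FX [x Xx sX]] := IH.
      by move=> z zs; apply: sU; rewrite inE zs orbT.
    have [|Y FY Yy] := sU y; first by rewrite inE eqxx.
    have [XY|YX] := Ftot _ _ FX FY.
      by exists Y => //; exists y => // z; rewrite inE => /orP[/eqP->//|/sX/XY].
    by exists X => //; exists x => // z; rewrite inE => /orP[/eqP->|/sX//]; exact: YX.
  have [XI QX] := ideal_of _ _ FX Xx; right.
  suff -> : \bigcup_(X in F) X = X by [].
  apply/seteqP; split; last by move=> y Xy; exists X.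
  by rewrite Us; apply: ideal_gen_sub.
(* The counterexample [J] itself is strictly above the empty set. *)
have A0 : A <> set0.
  move=> A0; apply: (Amax J); last by right.
  by rewrite A0; split=> // /(_ 0 (ideal0 JI)).
have [//|[AI QA]] := Abad.
apply: QA; apply: step => // J' J'I AJ'; apply: contrapT => QJ'.
by apply: (Amax J') => //; right.
Qed.

(** If powers of [f] lie in [J + (u)] and in [J + (v)], their product lies in [J], because [u * v]
    does. *)
Lemma radical_split J u v : is_ideal J -> radical J = J -> J (u * v) ->
  J = radical (ideal_add J (range (fun a => a * u))) `&`
      radical (ideal_add J (range (fun a => a * v))).
Proof.
move=> JI Jrad Juv; apply/seteqP; split=> [f Jf|f [[n Jn] [k Jk]]].
  by split; apply/sub_radical; exists f => //; exists 0; rewrite ?addr0 //;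
    exists 0; rewrite ?mul0r.
rewrite -Jrad; exists (n + k)%N; rewrite exprD.
case: Jn => [f1 Jf1 [_ [a _ <-] <-]]; case: Jk => [f2 Jf2 [_ [b _ <-] <-]].
rewrite mulrDl; apply: idealD => //; first by rewrite mulrC; apply: idealMl.
rewrite mulrDr; apply: idealD => //; first by apply: idealMl.
by rewrite mulrACA; apply: idealMl.
Qed.

Lemma is_ideal_principal u : is_ideal (range (fun a : R => a * u)).
Proof.
split; first by exists 0; rewrite ?mul0r.
move=> a _ _ [b _ <-] [c _ <-]; exists (a * b + c) => //.
by rewrite mulrDl mulrA.
Qed.

(** By Noetherian induction: a proper radical ideal that is not prime is the intersection of two
    strictly larger radical ideals. The unit ideal is the empty intersection. *)
Lemma exists_finite_primes J : noetherian -> is_ideal J -> radical J = J ->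
  exists s : seq (set R),
    (forall P, P \in s -> is_prime_ideal P) /\ J = \bigcap_(P in [set` s]) P.
Proof.
move=> noeth; move: J; apply: (noetherian_ind noeth) => J JI IH Jrad.
have [J1|J1] := EM (J 1).
  exists [::]; split=> //; apply/seteqP; split=> // f _.
  by rewrite -[f]mulr1; apply: idealMl.
have [[u [v [Juv Ju Jv]]]|Jprime] := EM (exists u v, [/\ J (u * v), ~ J u & ~ J v]).
  have Jw w : ~ J w -> exists s : seq (set R),
      (forall P, P \in s -> is_prime_ideal P) /\
      radical (ideal_add J (range (fun a => a * w))) = \bigcap_(P in [set` s]) P.
    move=> Jw; have wI := is_ideal_principal w.
    apply: IH.
    - exact/is_ideal_radical/is_ideal_add.
    - split; first by move=> x Jx; apply/sub_radical/ideal_addl.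
      move=> /(_ w) wJ; apply/Jw/wJ/sub_radical/ideal_addr => //.
      by exists 1; rewrite ?mul1r.
    - by apply/seteqP; split; [exact: radical_sub_radical|exact: sub_radical].
  have [s [sp sE]] := Jw u Ju; have [t [tp tE]] := Jw v Jv.
  exists (s ++ t); split; first by move=> P; rewrite mem_cat => /orP[/sp|/tp].
  rewrite (radical_split JI Jrad Juv) sE tE.
  apply/seteqP; split=> [f [fs ft] P /=|f fst].
    by rewrite mem_cat => /orP[/fs|/ft].
  by split=> P Ps; apply: fst; rewrite /= mem_cat Ps ?orbT.
exists [:: J]; split; last first.
  apply/seteqP; split=> [f Jf P|f]; first by rewrite /= inE => /eqP ->.
  by apply; rewrite /= inE.
move=> P; rewrite inE => /eqP ->; apply: is_prime_idealP => // u v Juv.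
apply: contrapT => /not_orP[Ju Jv]; apply: Jprime; by exists u, v.
Qed.

Lemma exists_prime_decomposition J : noetherian -> is_ideal J ->
  exists D : set (set R), prime_decomposition D id (radical J).
Proof.
move=> noeth JI.
have [||s [sp sE]] := @exists_finite_primes (radical J) noeth.
- exact: is_ideal_radical.
- by apply/seteqP; split; [exact: radical_sub_radical|exact: sub_radical].
have [n] := ubnP (size s); elim: n s sp sE => // n IH s sp sE sn.
have [[P Ps PE]|irr] :=
  EM (exists2 P, P \in s & \bigcap_(Q in [set` s] `\ P) Q = radical J).
  (* The list may have repetitions; the filter removes every copy of [P]. *)
  have [||//|D DP] := IH (filter (predC1 P) s); last by exists D.
  - by move=> Q; rewrite mem_filter => /andP[_ /sp].
  - rewrite -PE; congr bigcap; apply/seteqP; split=> Q /=.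
      by move=> [Qs /eqP QP]; rewrite mem_filter /= QP.
    by rewrite mem_filter => /andP[/eqP ? ?].
  - move: sn; rewrite size_filter ltnS; apply: leq_trans.
    rewrite -(count_predC (pred1 P) s) -[X in (X < _)%N]add0n ltn_add2r.
    by rewrite -has_count has_pred1.
exists [set` s]; split=> // P Ps PE; by apply: irr; exists P.
Qed.

Lemma exists_prime_avoiding J f : noetherian -> is_ideal J -> ~ radical J f ->
  exists P, [/\ is_prime_ideal P, J `<=` P & ~ P f].
Proof.
move=> noeth JI Jf; have [D [_ Dp DE _]] := exists_prime_decomposition noeth JI.
apply: contrapT => none; apply: Jf; rewrite DE => P DP.
apply: contrapT => Pf; apply: none; exists P; split=> //; first exact: Dp.
by apply: subset_trans (@sub_radical J) _; rewrite DE => u; apply.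
Qed.

End IdealTheory.

(** * Hilbert's basis theorem *)

Section HilbertBasis.
Variable R : comNzRingType.
Implicit Types (J : set {poly R}) (p q : {poly R}) (s : seq R) (gs : seq {poly R}).

(** The leading coefficients in degree [d]; polynomials of smaller degree are allowed and contribute
    0, so that an ideal results. *)
Definition top_coefs J (d : nat) : set R :=
  [set c | exists p, [/\ J p, (size p <= d.+1)%N & p`_d = c]].

Lemma top_coefs_ideal J d : is_ideal J -> is_ideal (top_coefs J d).
Proof.
move=> JI; split.
  by exists 0; rewrite size_poly0 coef0; split=> //; exact: ideal0.
move=> a _ _ [p [Jp sp <-]] [q [Jq sq <-]]; exists (a%:P * p + q); split.
- by case: JI => _; apply.
- rewrite mul_polyC (leq_trans (size_polyD _ _)) // geq_max sq andbT.
  exact: leq_trans (size_scale_leq _ _) sp.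
- by rewrite coefD coefCM.
Qed.

Lemma top_coefs_leq J d e : is_ideal J -> (d <= e)%N ->
  top_coefs J d `<=` top_coefs J e.
Proof.
move=> JI /subnK <-; elim: (e - d)%N => [//|k IH] c /IH[p [Jp sp <-]].
exists ('X * p); split; first exact: idealMl.
  by rewrite mulrC (leq_trans (size_polyMleq _ _)) // size_polyX addnS /= addn1.
by rewrite coefXM.
Qed.

Lemma top_coefs_sub J J' d : J `<=` J' -> top_coefs J d `<=` top_coefs J' d.
Proof. by move=> s c [p [/s Jp sp pd]]; exists p. Qed.

(** Subtracting from [p] a member of [J'] with the same top coefficient lowers the degree and stays
    in [J]. *)
Lemma sub_of_top_coefs J J' : is_ideal J -> is_ideal J' -> J' `<=` J ->
  (forall d, top_coefs J d `<=` top_coefs J' d) -> J `<=` J'.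
Proof.
move=> JI J'I J'J top p; have [n] := ubnP (size p).
elim: n p => // n IH p; rewrite ltnS => sp Jp.
case: n IH sp => [_|n IH sp].
  by rewrite leqn0 size_poly_eq0 => /eqP ->; apply: ideal0.
have [|q [Jq sq qn]] := top n p`_n; first by exists p.
rewrite -[p](subrK q); apply: idealD => //; apply: IH; last first.
  by apply: idealB => //; apply: J'J.
rewrite ltnS; apply/leq_sizeP => j; rewrite leq_eqVlt => /orP[/eqP <-|nj].
  by rewrite coefB qn subrr.
have pj : p`_j = 0 by apply: nth_default; exact: leq_trans sp nj.
have qj : q`_j = 0 by apply: nth_default; exact: leq_trans sq nj.
by rewrite coefB pj qj subrr.
Qed.

(** Each of finitely many generators of [top_coefs J d] is lifted to a polynomial of [J]. *)
Lemma top_coefs_finite J d : noetherian R -> is_ideal J ->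
  exists2 gs, (forall g, g \in gs -> J g) &
    top_coefs J d `<=` top_coefs (ideal_gen gs) d.
Proof.
move=> noeth JI; have [s sE] := noeth _ (top_coefs_ideal d JI).
have [gs gsJ sgs] : exists2 gs, (forall g, g \in gs -> J g) &
    forall c, c \in s -> top_coefs (ideal_gen gs) d c.
  have : forall c, c \in s -> top_coefs J d c.
    by move=> c cs; rewrite sE; apply: ideal_gen_mem.
  elim: s {sE} => [|c s IH] sJ; first by exists [::].
  have [|gs gsJ sgs] := IH; first by move=> e es; apply: sJ; rewrite inE es orbT.
  have [|p [Jp sp pd]] := sJ c; first by rewrite inE eqxx.
  exists (p :: gs); first by move=> g; rewrite inE => /orP[/eqP ->|/gsJ].
  move=> e; rewrite inE => /orP[/eqP ->|/sgs].
    by exists p; split=> //; apply: ideal_gen_mem; rewrite inE eqxx.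
  apply: top_coefs_sub; apply: ideal_gen_sub; first exact: is_ideal_gen.
  by move=> g gg; apply: ideal_gen_mem; rewrite inE gg orbT.
exists gs => //; rewrite sE; apply: ideal_gen_sub => //.
exact/top_coefs_ideal/is_ideal_gen.
Qed.

Lemma top_coefs_finite_upto J n : noetherian R -> is_ideal J ->
  exists2 gs, (forall g, g \in gs -> J g) &
    forall d, (d <= n)%N -> top_coefs J d `<=` top_coefs (ideal_gen gs) d.
Proof.
move=> noeth JI.
have cat_sub gs hs g : g \in gs \/ g \in hs -> ideal_gen (gs ++ hs) g.
  by move=> ghs; apply: ideal_gen_mem; rewrite mem_cat; apply/orP.
elim: n => [|n [gs gsJ top]].
  have [gs gsJ top] := top_coefs_finite 0 noeth JI.
  by exists gs => // d; rewrite leqn0 => /eqP ->.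
have [hs hsJ htop] := top_coefs_finite n.+1 noeth JI.
exists (gs ++ hs); first by move=> g; rewrite mem_cat => /orP[/gsJ|/hsJ].
have cI := is_ideal_gen (gs ++ hs).
move=> d; rewrite leq_eqVlt ltnS => /orP[/eqP ->|/top {}top].
  apply: subset_trans htop _; apply: top_coefs_sub.
  by apply: ideal_gen_sub => // g gh; apply: cat_sub; right.
apply: subset_trans top _; apply: top_coefs_sub.
by apply: ideal_gen_sub => // g gg; apply: cat_sub; left.
Qed.

(** The increasing ideals [top_coefs J d] have a finitely generated union, so they are constant from
    some [n] on; lifts for the degrees up to [n] generate [J]. *)
Theorem noetherian_poly : noetherian R -> noetherian {poly R}.
Proof.
move=> noeth J JI; pose L := \bigcup_d top_coefs J d.
have LI : is_ideal L.
  split; first by exists 0%N => //; exact: ideal0 (top_coefs_ideal 0 JI).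
  move=> a u v [d _ du] [e _ ev]; exists (maxn d e) => //.
  have [_] := top_coefs_ideal (maxn d e) JI; apply.
    by apply: top_coefs_leq du => //; rewrite leq_maxl.
  by apply: top_coefs_leq ev => //; rewrite leq_maxr.
have [s sE] := noeth _ LI.
have [n sn] : exists n, forall c, c \in s -> top_coefs J n c.
  have : forall c, c \in s -> L c by move=> c cs; rewrite sE; apply: ideal_gen_mem.
  elim: s {sE} => [|c s IH] sL; first by exists 0%N.
  have [|n sn] := IH; first by move=> e es; apply: sL; rewrite inE es orbT.
  have [|d _ dc] := sL c; first by rewrite inE eqxx.
  exists (maxn n d) => e; rewrite inE => /orP[/eqP ->|/sn].
    by apply: top_coefs_leq dc => //; rewrite leq_maxr.
  by apply: top_coefs_leq => //; rewrite leq_maxl.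
have [gs gsJ top] := top_coefs_finite_upto n noeth JI.
have gI := is_ideal_gen gs.
exists gs; apply/seteqP; split; last exact: ideal_gen_sub.
apply: sub_of_top_coefs => //; first exact: ideal_gen_sub.
(* Beyond [n] the coefficient already occurs in degree [n], and multiplication by a power of the
   variable brings it back to degree [d]. *)
move=> d; have [dn|nd] := leqP d n; first exact: top.
move=> c dc; apply: (top_coefs_leq gI (ltnW nd)); apply: top => //.
have : L c by exists d.
by rewrite sE; apply: ideal_gen_sub => //; apply: top_coefs_ideal.
Qed.

End HilbertBasis.

(** * Ideals and Noetherian rings along ring morphisms *)

Lemma is_ideal_preimage (R S : comNzRingType) (f : {rmorphism R -> S}) J :
  is_ideal J -> is_ideal (f @^-1` J).
Proof.
move=> [J0 JM]; split; first by rewrite /preimage /= rmorph0.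
by move=> a u v; rewrite /preimage /= rmorphD rmorphM; apply: JM.
Qed.

Lemma is_prime_ideal_preimage (R S : comNzRingType) (f : {rmorphism R -> S}) P :
  is_prime_ideal P -> is_prime_ideal (f @^-1` P).
Proof.
move=> Pp; apply: is_prime_idealP.
- exact/is_ideal_preimage/prime_idealI.
- by rewrite /preimage /= rmorph1; exact: prime_ideal1.
- by move=> u v; rewrite /preimage /= rmorphM; exact: prime_idealM.
Qed.

Lemma noetherian_surj (R S : comNzRingType) (f : {rmorphism R -> S}) :
  (forall y, exists x, f x = y) -> noetherian R -> noetherian S.
Proof.
move=> fsurj noeth J JI; have [s sE] := noeth _ (is_ideal_preimage f JI).
have sJ x : x \in s -> J (f x).
  by move=> /ideal_gen_mem; rewrite -sE.
have fI := is_ideal_gen (map f s).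
exists (map f s); apply/seteqP; split; last first.
  by apply: ideal_gen_sub => // _ /mapP[x /sJ Jx ->].
move=> y; have [x <-] := fsurj y => Jfx.
have : ideal_gen s x by rewrite -sE.
apply: (@ideal_gen_sub _ s (f @^-1` ideal_gen (map f s))).
  exact: is_ideal_preimage.
by move=> z zs; apply: ideal_gen_mem; apply: map_f.
Qed.

Lemma noetherian_field (K : fieldType) : noetherian K.
Proof.
move=> J JI; have [[x Jx x0]|J0] := EM (exists2 x, J x & x != 0).
  exists [:: 1]; apply/seteqP; split=> y _.
    by rewrite -[y]mulr1; apply: idealMl (is_ideal_gen _) (ideal_gen_mem _);
      rewrite inE.
  by rewrite -[y](mulfVK x0); apply: idealMl.
exists [::]; apply/seteqP; split; last by apply: ideal_gen_sub.
move=> y Jy; have [->|y0] := eqVneq y 0; first exact: ideal0 (is_ideal_gen _).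
by case: J0; exists y.
Qed.

(** * Splitting off the last variable of a polynomial ring *)

Section LastVariable.
Variable R : comNzRingType.

(** Induction along the ring operations instead of along monomials, suited to comparing ring
    morphisms. *)
Lemma mpoly_ring_ind n (Q : {mpoly R[n]} -> Prop) :
  (forall c, Q c%:MP) -> (forall i, Q 'X_i) ->
  (forall p q, Q p -> Q q -> Q (p + q)) ->
  (forall p q, Q p -> Q q -> Q (p * q)) -> forall p, Q p.
Proof.
move=> QC QX QD QM p; rewrite [p]mpolyE.
apply: big_ind => // [|m _]; first by rewrite -mpolyC0.
rewrite -mul_mpolyC; apply: (QM) => //; rewrite mpolyXE_id.
apply: big_ind => // [|i _]; first by rewrite -mpolyC1.
by elim: (m i) => [|k IH]; rewrite ?expr0 -?mpolyC1 // exprS; apply: QM.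
Qed.

(** Substitutes the last variable for the indeterminate; ideals in [n.+1] variables are pulled back
    along it to one-variable polynomials over [n] variables. *)
Definition poly_mpoly n : {poly {mpoly R[n]}} -> {mpoly R[n.+1]} :=
  horner_eval 'X_ord_max \o map_poly (@mwiden n R).

HB.instance Definition _ n := GRing.RMorphism.on (@poly_mpoly n).

Lemma poly_mpoly_surj n (p : {mpoly R[n.+1]}) : exists q, poly_mpoly q = p.
Proof.
elim/mpoly_ring_ind: p => [c|i|_ _ [p <-] [q <-]|_ _ [p <-] [q <-]].
- exists (c%:MP)%:P; rewrite /poly_mpoly /= map_polyC /horner_eval hornerC.
  exact: mwidenC.
- have [j ->|->] := unliftP ord_max i; last first.
    by exists 'X; rewrite /poly_mpoly /= map_polyX /horner_eval hornerX.
  exists ('X_j)%:P; rewrite /poly_mpoly /= map_polyC /horner_eval hornerC.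
  rewrite /= mwidenX mnmwiden1; congr 'X_[U_(_)%MM].
  by apply/val_inj; rewrite /= /bump leqNgt ltn_ord.
- by exists (p + q); rewrite rmorphD.
- by exists (p * q); rewrite rmorphM.
Qed.

Lemma noetherian_mpolyS n :
  noetherian {mpoly R[n]} -> noetherian {mpoly R[n.+1]}.
Proof.
by move=> /noetherian_poly; apply: noetherian_surj; exact: poly_mpoly_surj.
Qed.

End LastVariable.

Theorem noetherian_mpoly (K : fieldType) n : noetherian {mpoly K[n]}.
Proof.
elim: n => [|n IH]; last first.
  exact: noetherian_mpolyS.
apply: (@noetherian_surj _ _ (@mpolyC 0 K)); last exact: noetherian_field.
elim/mpoly_ring_ind=> [c|[]//|_ _ [p <-] [q <-]|_ _ [p <-] [q <-]].
- by exists c.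
- by exists (p + q); rewrite rmorphD.
- by exists (p * q); rewrite rmorphM.
Qed.

(** * The Nullstellensatz *)

(** Leading terms with coefficient in [p] are moved into [e] one by one; a coefficient outside [p]
    stops the process. *)
Lemma trim_leading_coefs (R : comNzRingType) (p : set R) (f : {poly R}) :
  is_ideal p -> (exists i, ~ p f`_i) ->
  exists f' e : {poly R}, [/\ (size f' <= size f)%N, ~ p (lead_coef f'),
                   forall i, p e`_i & f = f' + e].
Proof.
move=> pI; have [n] := ubnP (size f); elim: n f => // n IH f.
rewrite ltnS => sf [i fi].
have [pl|pl] := EM (p (lead_coef f)); last first.
  by exists f, 0; split=> // [j|]; rewrite ?addr0 // coef0; exact: ideal0.
have f0 : f != 0.
  by apply/eqP => f0; apply: fi; rewrite f0 coef0; exact: ideal0.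
pose m := lead_coef f *: 'X^((size f).-1); pose g := f - m.
have pm j : p m`_j.
  by rewrite coefZ coefXn mulrC; apply: idealMl.
have sg : (size g < size f)%N.
  rewrite (polySpred f0) ltnS; apply/leq_sizeP => j.
  rewrite leq_eqVlt => /orP[/eqP <-|fj].
    by rewrite coefB coefZ coefXn eqxx mulr1 subrr.
  rewrite coefB coefZ coefXn (gtn_eqF fj) mulr0 subr0 nth_default //.
  by rewrite (polySpred f0).
have [||f' [e [sf' lf' pe gE]]] := IH g.
- exact: leq_trans sg sf.
- exists i => gi; apply: fi; rewrite -[f](subrK m) coefD.
  exact: idealD.
exists f', (e + m); split=> //; first exact: leq_trans sf' (ltnW sg).
  by move=> j; rewrite coefD; apply: idealD.
by rewrite addrA -gE subrK.
Qed.

Lemma ideal_of_coefs (R : comNzRingType) (J : set {poly R}) (e : {poly R}) :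
  is_ideal J -> (forall i, J (e`_i)%:P) -> J e.
Proof.
move=> JI Je; rewrite -[e]coefK poly_def; apply: ideal_sum => // i _.
by rewrite -mul_polyC mulrC; apply: idealMl.
Qed.

(* Let h in J \ P have least degree.  Pseudo-division by g gives deg h < deg g;
   pseudo-division of g by h then has its remainder in P, hence its quotient too,
   and if h is not constant both have degree less than deg g, so all their
   coefficients lie in P, contradicting the hypothesis on lead_coef g. *)
Lemma poly_prime_constant (R : idomainType) (P J : set {poly R}) (g : {poly R}) :
  is_prime_ideal P -> is_ideal J -> P `<` J ->
  P g -> ~ P (lead_coef g)%:P ->
  (forall k, P k -> (size k < size g)%N -> forall i, P (k`_i)%:P) ->
  exists2 a, J a%:P & ~ P a%:P.
Proof.
move=> Pp JI [PJ JP] Pg lg gmin; have PI := prime_idealI Pp.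
have pI := is_ideal_preimage (@polyC R) PI.
have trim f : J f -> ~ P f ->
    exists f', [/\ J f', ~ P f', ~ P (lead_coef f')%:P & (size f' <= size f)%N].
  move=> Jf Pf.
  have [||f' [e [sf lf pe fE]]] := @trim_leading_coefs _ (polyC @^-1` P) f.
  - exact: pI.
  - by apply: contrapT => none; apply: Pf; apply: ideal_of_coefs => // i;
      apply: contrapT => fi; apply: none; exists i.
  have Pe : P e by apply: ideal_of_coefs.
  exists f'; split=> //.
    by rewrite -[f'](addrK e) -fE; apply: idealB => //; exact: PJ.
  by move=> Pf'; apply: Pf; rewrite fE; apply: idealD.
pose least n := `[< exists h, [/\ J h, ~ P h, ~ P (lead_coef h)%:P & size h = n] >].
have [n ex_n] : exists n, least n.
  have [f Jf Pf] : exists2 f, J f & ~ P f.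
    apply: contrapT => none; apply: JP => f Jf; apply: contrapT => Pf.
    by apply: none; exists f.
  have [h [Jh Ph lh _]] := trim f Jf Pf.
  by exists (size h); apply/asboolP; exists h.
case: (ex_minnP (ex_intro _ n ex_n)) => {n ex_n} n /asboolP[h [Jh Ph lh <-]] hmin.
(* Otherwise trimming [k] would give a candidate smaller than [h]. *)
have hminP k : J k -> (size k < size h)%N -> P k.
  move=> Jk sk; apply: contrapT => Pk; have [k' [Jk' Pk' lk' sk']] := trim k Jk Pk.
  have := hmin (size k').
  rewrite leqNgt (leq_ltn_trans sk' sk) => /(_ _)/negP; apply=> //.
  by apply/asboolP; exists k'.
have nz k : ~ P (lead_coef k)%:P -> k != 0.
  move=> lk; apply/eqP => k0; apply: lk.
  by rewrite k0 lead_coef0 polyC0; exact: ideal0.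
(* Modulo [P], the powers of leading coefficients produced by pseudo-division can be cancelled. *)
have scaleP k s u : P (lead_coef k ^+ s *: u) -> ~ P (lead_coef k)%:P -> P u.
  rewrite -mul_polyC => /(prime_idealM Pp)[|//].
  by rewrite polyC_exp => /(prime_idealX Pp).
have [h0 g0] := (nz h lh, nz g lg).
have shg : (size h < size g)%N.
  rewrite ltnNge; apply/negP => sgh.
  have E := Pdiv.WeakIdomain.divp_eq h g.
  have Pr : P (h %% g)%R.
    apply: hminP; last by apply: leq_trans sgh; rewrite Pdiv.CommonIdomain.ltn_modp.
    rewrite -[(h %% g)%R](addKr ((h %/ g) * g)) -E addrC -mul_polyC.
    by apply: idealB => //; apply: idealMl => //; exact: PJ.
  apply: Ph; apply: (scaleP g (scalp h g)) => //; rewrite E; apply: idealD => //.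
  by apply: idealMl.
have E := Pdiv.WeakIdomain.divp_eq g h.
have Pr : P (g %% h)%R.
  apply: hminP; last by rewrite Pdiv.CommonIdomain.ltn_modp.
  rewrite -[(g %% h)%R](addKr ((g %/ h) * h)) -E addrC -mul_polyC.
  by apply: idealB => //; apply: idealMl => //; exact: PJ.
have Pq : P (g %/ h)%R.
  have : P ((g %/ h) * h).
    rewrite -[_ * h](addrK (g %% h)%R) -E; apply: idealB => //.
    by rewrite -mul_polyC; apply: idealMl.
  by move=> /(prime_idealM Pp)[].
exists (lead_coef h) => //; suff sh : (size h <= 1)%N.
  rewrite lead_coefE (_ : (size h).-1 = 0%N) -?size1_polyC //.
  by case: (size h) sh => [|[]].
rewrite leqNgt; apply/negP => sh.
have cr := gmin _ Pr (ltn_trans _ shg).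
have cq : forall i, P ((g %/ h)%R`_i)%:P.
  apply: gmin => //; rewrite Pdiv.CommonIdomain.size_divp //.
  rewrite ltn_subrL (ltn_trans _ shg) ?andbT; last exact: ltn_trans sh.
  by rewrite -ltnS prednK // ltnW.
have : P ((lead_coef h ^+ scalp g h *: g)`_(size g).-1)%:P.
  rewrite E coefD polyCD coefM raddf_sum; apply: idealD => //; last first.
    by apply: cr; rewrite Pdiv.CommonIdomain.ltn_modp.
  apply: ideal_sum => // i _; rewrite /= polyCM mulrC.
  exact: idealMl.
rewrite coefZ polyCM polyC_exp => /(prime_idealM Pp)[/(prime_idealX Pp)//|].
by rewrite -lead_coefE.
Qed.

(** The induction step on the number of variables. The predicate [good] carries along what must be
    remembered of [phi], later that it is evaluation at a point. *)
Lemma poly_point (R : idomainType) (L : closedFieldType)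
    (good : {rmorphism R -> L} -> Prop) :
  (forall (P : set R) f, is_prime_ideal P -> ~ P f ->
   exists phi : {rmorphism R -> L},
     [/\ good phi, forall g, P g -> phi g = 0 & phi f != 0]) ->
  forall (P : set {poly R}) f, is_prime_ideal P -> ~ P f ->
  exists (phi : {rmorphism R -> L}) (y : L),
     [/\ good phi, forall g, P g -> (map_poly phi g).[y] = 0
       & (map_poly phi f).[y] != 0].
Proof.
move=> IH P f Pp Pf; have PI := prime_idealI Pp.
have pp := is_prime_ideal_preimage (@polyC R) Pp.
have map0 (phi : {rmorphism R -> L}) (k : {poly R}) :
    (forall c, P c%:P -> phi c = 0) ->
    (forall i, P (k`_i)%:P) -> map_poly phi k = 0.
  by move=> phi0 Pk; apply/polyP => i; rewrite coef_map coef0; exact: phi0.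
pose least n := `[< exists g, [/\ P g, ~ P (lead_coef g)%:P & size g = n] >].
(* Without such a [g], all coefficients of members of [P] lie in [P], so a suitable [phi] kills them
   all; then [y] is any non-root of the image of [f]. *)
have [[n ex_n]|none] := EM (exists n, least n); last first.
  have Pcoef (g : {poly R}) i : P g -> P (g`_i)%:P.
    move=> Pg; apply: contrapT => gi.
    have [||g' [e [_ lg pe gE]]] := @trim_leading_coefs _ (polyC @^-1` P) g.
    - exact: prime_idealI.
    - by exists i.
    apply: none; exists (size g'); apply/asboolP; exists g'; split=> //.
    rewrite -[g'](addrK e) -gE; apply: idealB => //.
    exact: ideal_of_coefs.
  have [i fi] : exists i, ~ P (f`_i)%:P.
    apply: contrapT => all_in; apply: Pf; apply: ideal_of_coefs => // i.
    by apply: contrapT => fi; apply: all_in; exists i.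
  have [phi [gphi phi0 phif]] := IH _ _ pp fi.
  have /closed_nonrootP[y fy] : map_poly phi f != 0.
    by apply/eqP => /polyP/(_ i); rewrite coef_map coef0; apply/eqP.
  exists phi, y; split=> // g Pg.
  by rewrite map0 ?horner0 // => j; exact: Pcoef.
case: (ex_minnP (ex_intro _ n ex_n)) => {n ex_n} n /asboolP[g [Pg lg <-]] gmin.
have gminP (k : {poly R}) : P k -> (size k < size g)%N -> forall i, P (k`_i)%:P.
  move=> Pk sk i; apply: contrapT => ki.
  have [||k' [e [sk' lk pe kE]]] := @trim_leading_coefs _ (polyC @^-1` P) k.
  - exact: prime_idealI.
  - by exists i.
  have := gmin (size k').
  rewrite leqNgt (leq_ltn_trans sk' sk) => /(_ _)/negP; apply=> //.
  apply/asboolP; exists k'; split=> //.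
  rewrite -[k'](addrK e) -kE; apply: idealB => //.
  exact: ideal_of_coefs.
have FI := is_ideal_principal f.
(* A constant [a = v + b * f] outside [P], with [v] in [P]: where [P] vanishes and [a] does not, [f]
   cannot vanish. *)
have [|||||a [v Pv [_ [b _ <-] aE]] Pa] :=
  @poly_prime_constant R P (ideal_add P (range (fun a => a * f))) g Pp.
- exact: is_ideal_add.
- split; first exact: ideal_addl.
  move=> /(_ f) sub; apply: Pf; apply: sub; apply: ideal_addr => //.
  by exists 1; rewrite ?mul1r.
- by [].
- exact: lg.
- exact: gminP.
(* Besides [a], the morphism must not kill [lead_coef g]: the image of [g] then keeps its degree,
   and has a root since [g] is not constant. *)
have [|phi [gphi phi0]] := IH _ (a * lead_coef g) pp.
  by rewrite /preimage /= polyCM => /(prime_idealM Pp)[].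
rewrite rmorphM mulf_eq0 => /norP[phia phig].
have /closed_rootP[y /rootP gy] : size (map_poly phi g) != 1.
  rewrite size_map_poly_id0 //; apply/eqP => g1; apply: lg.
  by rewrite lead_coefE g1 -size1_polyC // g1.
(* The remainder of [k] by [g] lies in [P] and is shorter than [g], so [phi] kills its coefficients;
   at a root of [g] a nonzero multiple of the value of [k] is thus 0. *)
have Py k : P k -> (map_poly phi k).[y] = 0.
  move=> Pk; have E := Pdiv.WeakIdomain.divp_eq k g.
  have Pr : P (k %% g)%R.
    rewrite -[(k %% g)%R](addKr ((k %/ g) * g)) -E addrC -mul_polyC.
    by apply: idealB => //; apply: idealMl.
  have g0 : g != 0.
    by apply/eqP => g0; apply: lg; rewrite g0 lead_coef0 polyC0; exact: ideal0.
  have := congr1 (fun q => (map_poly phi q).[y]) E.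
  rewrite rmorphD rmorphM hornerD hornerM gy mulr0 add0r [X in _ = X.[_]]map0 //.
    rewrite horner0 map_polyZ hornerZ rmorphXn /= => /eqP.
    by rewrite mulf_eq0 expf_eq0 (negPf phig) andbF => /eqP.
  by apply: gminP => //; rewrite Pdiv.CommonIdomain.ltn_modp.
exists phi, y; split=> //; apply/eqP => fy.
have := congr1 (fun q => (map_poly phi q).[y]) aE.
rewrite rmorphD rmorphM hornerD hornerM fy mulr0 addr0 /= (Py v Pv) map_polyC hornerC.
by move=> /esym/eqP; apply/negP.
Qed.

(** * Points of prime ideals over an algebraically closed extension *)

Section Evaluation.
Variables (K : fieldType) (L : closedFieldType) (iota : {rmorphism K -> L}).

Definition eval_at m (x : 'I_m -> L) : {mpoly K[m]} -> L :=
  meval x \o map_mpoly iota.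

HB.instance Definition _ m x := GRing.RMorphism.on (@eval_at m x).

Lemma eval_atC m (x : 'I_m -> L) c : eval_at x c%:MP = iota c.
Proof. by rewrite /eval_at /= map_mpolyC mevalC. Qed.

Lemma eval_atX m (x : 'I_m -> L) i : eval_at x 'X_i = x i.
Proof. by rewrite /eval_at /= map_mpolyX mevalXU. Qed.

Lemma eval_at_widen m (x : 'I_m.+1 -> L) (p : {mpoly K[m]}) :
  eval_at x (mwiden p) = eval_at (fun i => x (widen_ord (leqnSn m) i)) p.
Proof.
elim/mpoly_ring_ind: p => [c|i|p q IHp IHq|p q IHp IHq].
- by rewrite mwidenC !eval_atC.
- by rewrite mwidenX mnmwiden1 !eval_atX.
- by rewrite !rmorphD /= IHp IHq.
- by rewrite !rmorphM /= IHp IHq.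
Qed.

Theorem mpoly_point m (P : set {mpoly K[m]}) f : is_prime_ideal P -> ~ P f ->
  exists x : 'I_m -> L, (forall g, P g -> eval_at x g = 0) /\ eval_at x f != 0.
Proof.
elim: m P f => [|m IH] P f Pp Pf.
  have const (p : {mpoly K[0]}) : exists c, p = c%:MP.
    elim/mpoly_ring_ind: p => [c|[]//|_ _ [p ->] [q ->]|_ _ [p ->] [q ->]].
    - by exists c.
    - by exists (p + q); rewrite rmorphD.
    - by exists (p * q); rewrite rmorphM.
  have PI := prime_idealI Pp.
  (* There are no coordinates, so the value 0 is a dummy. *)
  exists (fun=> 0); split=> [g|].
    have [c ->] := const g; have [->|c0] := eqVneq c 0.
      by rewrite mpolyC0 rmorph0.
    move=> Pc; case: (prime_ideal1 Pp).
    by rewrite -mpolyC1 -(mulVf c0) mpolyCM; exact: idealMl.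
  have [c fc] := const f; rewrite fc eval_atC fmorph_eq0; apply/eqP => c0.
  by apply: Pf; rewrite fc c0 mpolyC0; exact: ideal0.
pose psi : {rmorphism {poly {mpoly K[m]}} -> {mpoly K[m.+1]}} := @poly_mpoly K m.
have [f' ff'] := poly_mpoly_surj f.
have Pf' : ~ (psi @^-1` P) f' by rewrite /preimage /= /psi ff'.
have Pp' : is_prime_ideal (psi @^-1` P) by exact: is_prime_ideal_preimage.
have [|phi [y [[x phix] yP fy]]] := @poly_point _ L
    (fun phi => exists x : 'I_m -> L, phi =1 eval_at x) _ _ _ Pp' Pf'.
  move=> Q h Qp Qh; have [x [xQ xh]] := IH Q h Qp Qh.
  by exists (eval_at x); split=> //; exists x.
(* The root [y] becomes the last coordinate, matching the variable substituted by [poly_mpoly]. *)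
pose x' i := if unlift ord_max i is Some j then x j else y.
have x'psi q : eval_at x' (psi q) = (map_poly phi q).[y].
  elim/poly_ind: q => [|q c IHq]; first by rewrite rmorph0 !rmorph0 horner0.
  rewrite !(rmorphD, rmorphM) /= IHq map_polyX map_polyC hornerMXaddC.
  congr (_ * _ + _).
    rewrite /psi /poly_mpoly /= map_polyX /horner_eval hornerX eval_atX.
    by rewrite /x' unlift_none.
  rewrite /psi /poly_mpoly /= map_polyC /horner_eval hornerC phix eval_at_widen.
  congr (eval_at _ _); apply/funext => i; rewrite /x'.
  rewrite (_ : widen_ord _ i = lift ord_max i) ?liftK //.
  by apply/val_inj; rewrite /= /bump leqNgt ltn_ord.
exists x'; split=> [g|]; last by rewrite -ff' x'psi.
by have [g' <-] := poly_mpoly_surj g => Pg; rewrite x'psi; exact: yP.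
Qed.

End Evaluation.

(** * Extension of scalars *)

Section ScalarExtension.
Variables (K : fieldType) (L : closedFieldType) (iota : {rmorphism K -> L}).

(** If [f] is not in the radical, some prime above [J] misses [f] and has a zero where [f] does not
    vanish. *)
Lemma nullstellensatz m (J : set {mpoly K[m]}) f : is_ideal J ->
  (forall x : 'I_m -> L, (forall g, J g -> eval_at iota x g = 0) ->
     eval_at iota x f = 0) -> radical J f.
Proof.
move=> JI Jf; apply: contrapT => radf.
have [P [Pp JP Pf]] := exists_prime_avoiding (@noetherian_mpoly K m) JI radf.
have [x [Px /eqP]] := mpoly_point iota Pp Pf; apply; apply: Jf => g /JP.
exact: Px.
Qed.

(** [L] is seen as a [K]-vector space through [iota]; only the values of [c] below [size b]
    count. *)
Definition lin_comb (b : seq L) (c : nat -> K) : L :=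
  \sum_(i < size b) iota (c i) * b`_i.

Lemma exists_independent_span (s : seq L) : exists b : seq L,
  (forall c, lin_comb b c = 0 -> forall i, (i < size b)%N -> c i = 0) /\
  (forall x, x \in s -> exists c, x = lin_comb b c).
Proof.
elim: s => [|x s [b [indep span]]]; first by exists [::].
have [[c xE]|xN] := EM (exists c, x = lin_comb b c).
  by exists b; split=> // y; rewrite inE => /orP[/eqP ->|/span//]; exists c.
have consE c : lin_comb (x :: b) c = iota (c 0%N) * x + lin_comb b (c \o S).
  by rewrite /lin_comb big_ord_recl.
exists (x :: b); split=> [c|y].
  rewrite consE => c0; have c00 : c 0%N = 0.
    apply: contrapT => /eqP nz; apply: xN.
    (* A relation with nonzero coefficient at [x], solved for [x]. *)
    exists (fun i => - (c 0%N)^-1 * c i.+1).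
    have iz : iota (c 0%N) != 0 by rewrite fmorph_eq0.
    apply: (mulfI iz); have -> : iota (c 0%N) * x = - lin_comb b (c \o S).
      by apply/eqP; rewrite -addr_eq0 c0.
    rewrite /lin_comb mulr_sumr -sumrN; apply: eq_bigr => i _ /=.
    by rewrite rmorphM rmorphN fmorphV mulrA mulrA mulrN divff // mulN1r mulNr.
  move: c0; rewrite c00 rmorph0 mul0r add0r => /indep c0 [//|i].
  by rewrite ltnS => /c0.
rewrite inE => /orP[/eqP ->|/span[c ->]].
  exists (fun i => (i == 0%N)%:R); rewrite consE /= rmorph1 mul1r /lin_comb.
  by rewrite big1 ?addr0 // => i _; rewrite /= rmorph0 mul0r.
exists (fun i => if i is j.+1 then c j else 0).
by rewrite consE rmorph0 mul0r add0r.
Qed.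

Variable m : nat.
Local Notation poly := {mpoly K[m]}.
Local Notation "p ^L" := (map_mpoly iota p) (at level 2, format "p ^L").

Definition coef_comb (b : seq L) (p : nat -> poly) : {mpoly L[m]} :=
  \sum_(i < size b) b`_i *: (p i)^L.

(** Plays the part of the tensor product over [K] of [P] with the span of [b]. *)
Definition combs_in (b : seq L) (P : set poly) : set {mpoly L[m]} :=
  [set coef_comb b p | p in [set p | forall i, P (p i)]].

Lemma combs_in_scale b P x f : is_ideal P -> P f ->
  (exists c, x = lin_comb b c) -> combs_in b P (x *: f^L).
Proof.
move=> PI Pf [c ->]; exists (fun i => (c i)%:MP * f).
  by move=> i; exact: idealMl.
rewrite /coef_comb /lin_comb scaler_suml; apply: eq_bigr => i _.
by rewrite rmorphM /= map_mpolyC mul_mpolyC scalerA mulrC.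
Qed.

Lemma combs_in_sum b P (I : eqType) (r : seq I) (F : I -> {mpoly L[m]}) :
  is_ideal P -> (forall i, i \in r -> combs_in b P (F i)) ->
  combs_in b P (\sum_(i <- r) F i).
Proof.
move=> PI PF; rewrite big_seq; apply: big_ind => //.
  exists (fun=> 0); first by move=> i; exact: ideal0.
  by rewrite /coef_comb big1 // => i _; rewrite rmorph0 scaler0.
move=> _ _ [p Pp <-] [q Pq <-]; exists (fun i => p i + q i).
  by move=> i; exact: idealD.
rewrite /coef_comb -big_split; apply: eq_bigr => i _ /=.
by rewrite rmorphD scalerDr.
Qed.

(** Comparing the coefficients of each monomial reduces this to the independence of [b]. *)
Lemma coef_comb_inj b p q :
  (forall c, lin_comb b c = 0 -> forall i, (i < size b)%N -> c i = 0) ->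
  coef_comb b p = coef_comb b q -> forall i, (i < size b)%N -> p i = q i.
Proof.
move=> indep pq i ib; apply/mpolyP => mm; apply/eqP; rewrite -subr_eq0; apply/eqP.
move: i ib; apply: (indep (fun i => (p i)@_mm - (q i)@_mm)).
have := congr1 (mcoeff mm) pq; rewrite !raddf_sum /= => /eqP.
rewrite -subr_eq0 -sumrB => /eqP <-; apply: eq_bigr => i _.
by rewrite !mcoeffZ !mcoeff_map_mpoly -mulrBr -rmorphB mulrC.
Qed.

(** The ideal generated by [P] over [L]. Linear combinations with scalars suffice, because [P]
    absorbs monomials. *)
Definition extension (P : set poly) : set {mpoly L[m]} :=
  [set h | exists s : seq (L * poly), (forall q, q \in s -> P q.2) /\
     h = \sum_(q <- s) q.1 *: q.2^L].

Lemma extension_scale P x f : P f -> extension P (x *: f^L).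
Proof.
move=> Pf; exists [:: (x, f)]; split; last by rewrite big_seq1.
by move=> q; rewrite inE => /eqP ->.
Qed.

Lemma is_ideal_extension P : is_ideal P -> is_ideal (extension P).
Proof.
move=> PI.
have ext0 : extension P 0 by exists [::]; split; rewrite ?big_nil.
have extD u v : extension P u -> extension P v -> extension P (u + v).
  move=> [s [Ps ->]] [t [Pt ->]]; exists (s ++ t); rewrite big_cat; split=> // q.
  by rewrite mem_cat => /orP[/Ps|/Pt].
split=> // a u v [s [Ps ->]] extv; apply: (extD) => //.
rewrite [a]mpolyE mulr_suml; apply: big_ind => // mm _.
rewrite mulr_sumr big_seq; apply: big_ind => // q qs.
have Pq := Ps q qs.
rewrite -scalerAl -scalerAr scalerA -(map_mpolyX iota mm) -rmorphM.
by apply: extension_scale; apply: idealMl.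
Qed.

Lemma extension_root P x h : extension P h ->
  (forall f, P f -> eval_at iota x f = 0) -> h.@[x] = 0.
Proof.
move=> [s [Ps ->]] Px; rewrite raddf_sum /= big_seq big1 // => q /Ps Pq.
by rewrite mevalZ -[_.@[x]]/(eval_at iota x q.2) Px ?mulr0.
Qed.

(* Flatness of the extension: f stays a nonzerodivisor modulo P after extending
   the scalars. *)
Lemma extension_mul_notin P f h : is_prime_ideal P -> ~ P f ->
  extension P (h * f^L) -> extension P h.
Proof.
move=> Pp Pf [s [Ps hfE]]; have PI := prime_idealI Pp.
(* An independent family whose span contains all scalars occurring in [h] and in the given
   expression of its product with [f]. *)
have [b [indep span]] :=
  exists_independent_span ([seq h@_mm | mm <- msupp h] ++ [seq q.1 | q <- s]).
have [p _ hE] : combs_in b setT h.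
  rewrite [h]mpolyE; apply: combs_in_sum => [|mm hm]; first by [].
  rewrite -(map_mpolyX iota mm); apply: combs_in_scale => //.
  by apply: span; rewrite mem_cat; apply/orP; left; apply/mapP; exists mm.
have [g Pg gE] : combs_in b P (h * f^L).
  rewrite hfE; apply: combs_in_sum => // q qs; apply: combs_in_scale => //.
    exact: Ps.
  by apply: span; rewrite mem_cat; apply/orP; right; apply/mapP; exists q.
have pfE : coef_comb b (fun i => p i * f) = coef_comb b g.
  rewrite gE -hE /coef_comb mulr_suml; apply: eq_bigr => i _.
  by rewrite rmorphM scalerAl.
rewrite -hE /coef_comb; apply: ideal_sum; first exact: is_ideal_extension.
move=> i _; apply: extension_scale.
(* Equal coordinates: [p i * f = g i] lies in [P], and [f] does not, so [p i] does. *)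
have := coef_comb_inj indep pfE (ltn_ord i) => pf.
by case: (prime_idealM (u := p i) (v := f) Pp) => //; rewrite pf; exact: Pg.
Qed.

End ScalarExtension.

(** Lets the Nullstellensatz be applied to ideals over [L] itself. *)
Lemma eval_at_id (L : closedFieldType) m (x : 'I_m -> L) (p : {mpoly L[m]}) :
  eval_at idfun x p = p.@[x].
Proof.
elim/mpoly_ring_ind: p => [c|i|p q IHp IHq|p q IHp IHq].
- by rewrite eval_atC mevalC.
- by rewrite eval_atX mevalXU.
- by rewrite !rmorphD /= IHp IHq.
- by rewrite !rmorphM /= IHp IHq.
Qed.

(** The product of [g] and [f] vanishes on V(P), so a power of it lies in the extension of [P];
    flatness cancels the power of [f] and leaves a power of [g]. *)
Lemma dense_prime_complement (K : fieldType) (L : closedFieldType)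
    (iota : {rmorphism K -> L}) m (P : set {mpoly K[m]}) f (g : {mpoly L[m]}) :
  is_prime_ideal P -> ~ P f ->
  (forall x, (forall p, P p -> eval_at iota x p = 0) ->
     eval_at iota x f != 0 -> g.@[x] = 0) ->
  forall x, (forall p, P p -> eval_at iota x p = 0) -> g.@[x] = 0.
Proof.
move=> Pp Pf gP x xP; have EI := is_ideal_extension iota (prime_idealI Pp).
have [|n] := @nullstellensatz _ _ idfun _ _ (g * map_mpoly iota f) EI.
  move=> y Ey; rewrite eval_at_id mevalM -[(map_mpoly _ _).@[y]]/(eval_at iota y f).
  have [->|fy] := eqVneq (eval_at iota y f) 0; first by rewrite mulr0.
  rewrite gP ?mul0r // => p Pp'.
  rewrite -[LHS]eval_at_id; apply: Ey; rewrite -[map_mpoly _ _]scale1r.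
  exact: extension_scale.
have Pfn : ~ P (f ^+ n) by move=> /(prime_idealX Pp).
rewrite exprMn -rmorphXn => /(extension_mul_notin Pp Pfn)/extension_root/(_ xP).
by rewrite rmorphXn => /eqP; rewrite expf_eq0 => /andP[_ /eqP].
Qed.

(** * Can-specifications *)

Section Varieties.
Variables (K : fieldType) (L : closedFieldType) (iota : {rmorphism K -> L}).
Variable m : nat.
Local Notation poly := {mpoly K[m]}.
Local Notation point := ('I_m -> L).
Local Notation V := (variety iota).
Implicit Types (J N M P : set poly) (S C : set point) (Y : spec_family K m).

Lemma varietyP J x : V J x <-> forall f, J f -> eval_at iota x f = 0.
Proof.
split=> [Jx f Jf|Jx _ [f Jf <-]]; last exact: Jx.
by apply: Jx; exists f.
Qed.

Lemma variety_sub J J' : J `<=` J' -> V J' `<=` V J.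
Proof. by move=> s x /varietyP Jx; apply/varietyP => f /s; exact: Jx. Qed.

Lemma variety_radical J : V (radical J) = V J.
Proof.
apply/seteqP; split; first exact/variety_sub/sub_radical.
move=> x /varietyP Jx; apply/varietyP => f [n /Jx].
by rewrite rmorphXn => /eqP; rewrite expf_eq0 => /andP[_ /eqP].
Qed.

Lemma variety_add N M : is_ideal N -> is_ideal M ->
  V (ideal_add N M) = V N `&` V M.
Proof.
move=> NI MI; apply/seteqP; split=> [x Vx|x [/varietyP Nx /varietyP Mx]].
  by split; apply: variety_sub Vx; [exact: ideal_addl|exact: ideal_addr].
apply/varietyP => _ [f Nf [g Mg <-]].
by rewrite rmorphD /= Nx ?Mx ?addr0.
Qed.

(** At a point outside every V(F i), a product of elements not vanishing there lies in the
    intersection and does not vanish either. *)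
Lemma variety_bigcap (I : Type) (D : set I) (F : I -> set poly) :
  finite_set D -> (forall i, D i -> is_ideal (F i)) ->
  V (\bigcap_(i in D) F i) = \bigcup_(i in D) V (F i).
Proof.
move=> Dfin FI; apply/seteqP; split=> [x /varietyP Vx|x [i Di]]; last first.
  by apply: variety_sub => f; apply.
apply: contrapT => none.
have [||i Di|f /Vx fx /eqP] := @bigcap_ideal_meets _ I D F
    [set f | eval_at iota x f != 0] Dfin FI; last by [].
- by rewrite /= rmorph1 oner_neq0.
- by move=> f g /= fx gx; rewrite rmorphM mulf_neq0.
apply: contrapT => Fx; apply: none; exists i => //; apply/varietyP => f Ff.
by apply/eqP; apply: contrapT => /negP fx; apply: Fx; exists f.
Qed.

Definition vanishing S : set poly :=
  [set f | forall x, S x -> eval_at iota x f = 0].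

Lemma vanishing_variety J : is_ideal J -> vanishing (V J) = radical J.
Proof.
move=> JI; apply/seteqP; split=> [f Jf|f].
  by apply: (nullstellensatz (iota := iota)) => // x /varietyP /Jf.
by rewrite -variety_radical => Jf x /varietyP; apply.
Qed.

Lemma variety_closed J : zariski_closed (V J).
Proof. by eexists. Qed.

Lemma prime_decomposition_variety (I : Type) (D : set I) (F : I -> set poly) J :
  prime_decomposition D F J -> V J = \bigcup_(i in D) V (F i).
Proof.
move=> [Dfin Fp -> _]; apply: variety_bigcap => // i Di.
by apply: prime_idealI; apply: Fp.
Qed.

(** One [f] outside the prime [p.1] lies in all the finitely many ideals of [p.2]; the points of
    V(p.1) where [f] does not vanish belong to the component and are dense. *)
Lemma variety_sub_closure_component (p : set poly * set (set poly)) :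
  is_prime_ideal p.1 -> prime_decomposition p.2 id (\bigcap_(P in p.2) P) ->
  (forall P, p.2 P -> p.1 `<` P) ->
  V p.1 `<=` zariski_closure (component iota p).
Proof.
move=> Pp [Dfin Dp _ _] lt x /varietyP xP _ [[F ->] CF] g Fg.
have [|||P DP|f Df pf] := @bigcap_ideal_meets _ _ p.2 id (~` p.1) Dfin.
- by move=> P /Dp /prime_idealI.
- exact: prime_ideal1.
- by move=> u v pu pv /(prime_idealM Pp)[].
- have [_ nsub] := lt P DP; apply: contrapT => none; apply: nsub => f Pf.
  by apply: contrapT => pf; apply: none; exists f.
apply: (dense_prime_complement Pp pf) xP => y yP fy.
apply: (CF y) => //; split; first exact/varietyP.
by move=> [P DP /varietyP Py]; move/eqP: fy; apply; exact: Py (Df P DP).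
Qed.

(** * The closure of a set with a can-specification *)

Section CanonicalSpecification.
Variables (C : set point) (Y : spec_family K m).
Hypothesis YC : can_spec iota C Y.

Lemma can_spec_variety :
  \bigcup_(p in Y) V p.1 = V (\bigcap_(p in Y) p.1).
Proof. by case: YC => _ _ /prime_decomposition_variety. Qed.

Lemma can_spec_closure : zariski_closure C = \bigcup_(p in Y) V p.1.
Proof.
case: (YC) => _ CE [_ Yp _ _] Yd lt; apply/seteqP; split.
  apply: smallest_sub; first by rewrite can_spec_variety; exact: variety_closed.
  by rewrite CE => x [p pY [px _]]; exists p.
move=> x [p pY px].
move=> T [Tclosed CT].
have := variety_sub_closure_component (Yp p pY) (Yd p pY) (lt p pY) px; apply.
by split=> // y py; apply: CT; rewrite CE; exists p.
Qed.

(** An intersection of primes is radical, hence the vanishing ideal of its own variety, here the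
    closure of [C]. *)
Lemma can_spec_vanishing : \bigcap_(p in Y) p.1 = vanishing (zariski_closure C).
Proof.
case: (YC) => _ _ [_ Yp _ _] _ _.
have YI : is_ideal (\bigcap_(p in Y) p.1).
  by apply: is_ideal_bigcap => p /Yp /prime_idealI.
rewrite can_spec_closure can_spec_variety (vanishing_variety YI).
by rewrite (radical_bigcap_primes Yp).
Qed.

End CanonicalSpecification.

(** V(p.1) lies in the closure of [C], hence in V(N); inside V(N), lying in V(M) means lying outside
    [C]. *)
Lemma assoc_can_spec_inter C Y : assoc_can_spec iota C Y ->
  exists M, [/\ is_ideal M, forall p, Y p -> V p.1 `&` V M = V p.1 `\` C
    & forall p, Y p -> \bigcap_(P in p.2) P = radical (ideal_add M p.1)].
Proof.
move=> [YC [N [M [[NI MI NM _] CE Yrad]]]]; exists M => //; split=> // p pY.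
have pN : V p.1 `<=` V N.
  have : zariski_closure C `<=` V N.
    by apply: smallest_sub; [exact: variety_closed|rewrite CE => x []].
  by apply: subset_trans; rewrite (can_spec_closure YC) => x px; exists p.
rewrite CE; apply/seteqP; split=> x [px]; first by move=> Mx; split=> // -[].
by move=> xC; split=> //; apply: contrapT => Mx; apply: xC; split=> //; exact: pN.
Qed.

Lemma assoc_can_spec_vanishing C Y p : assoc_can_spec iota C Y -> Y p ->
  \bigcap_(P in p.2) P = vanishing (V p.1 `\` C).
Proof.
move=> YC pY; have [M [MI pM radp]] := assoc_can_spec_inter YC.
have pI : is_ideal p.1.
  by case: YC => -[_ _ [_ Yp _ _] _ _] _; by apply: prime_idealI; apply: Yp.
rewrite radp // -pM // setIC -variety_add // vanishing_variety //.
exact: is_ideal_add.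
Qed.

(** The first ideals are the minimal primes of one ideal determined by [C]. Once they agree, the
    second ones are the minimal primes of the vanishing ideal of V(p.1) minus [C]. *)
Lemma assoc_can_spec_sub C Y Y' :
  assoc_can_spec iota C Y -> assoc_can_spec iota C Y' -> Y `<=` Y'.
Proof.
move=> YC Y'C p pY; have [[_ _ Yd Yd2 _] _] := YC; have [[_ _ Yd' Yd2' _] _] := Y'C.
have fstE : fst @` Y = fst @` Y'.
  rewrite (prime_decomposition_minimal Yd) (prime_decomposition_minimal Yd').
  by rewrite (can_spec_vanishing YC.1) (can_spec_vanishing Y'C.1).
have [q qY' qp] : (fst @` Y') p.1 by rewrite -fstE; exists p.
suff <- : q = p by [].
case: p pY qp => p1 p2 pY; case: q qY' => q1 q2 qY' /= qp; congr (_, _) => //.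
have := prime_decomposition_minimal (Yd2 _ pY).
have := prime_decomposition_minimal (Yd2' _ qY').
rewrite !image_id /= => -> ->.
have := assoc_can_spec_vanishing YC pY; have := assoc_can_spec_vanishing Y'C qY'.
by rewrite /= => -> ->; rewrite qp.
Qed.

(** Each [P] in [p.2] contains [M], so a point of V(p.1) on V(P) lies in V(M) and hence outside
    [C]. *)
Lemma assoc_can_spec_component C Y p : assoc_can_spec iota C Y -> Y p ->
  C `&` V p.1 `<=` component iota p.
Proof.
move=> YC pY x [Cx px]; have [M [MI pM radp]] := assoc_can_spec_inter YC.
split=> // -[P Pp Px]; suff : (V p.1 `\` C) x by case.
rewrite -pM //; split=> //.
have sub : M `<=` P.
  have pI : is_ideal p.1.
    by case: YC => -[_ _ [_ Yp _ _] _ _] _; by apply: prime_idealI; apply: Yp.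
  apply: (@subset_trans _ (radical (ideal_add M p.1))).
    by apply: subset_trans (@sub_radical _ _); exact: ideal_addl.
  by rewrite -radp // => f; apply.
exact: variety_sub sub _ Px.
Qed.

(** * Correctness of the algorithm *)

(* The output of the algorithm for a prime decomposition F of N and prime
   decompositions T i of M + F i. *)
Definition diff_to_can (I : Type) (D : set I) (F : I -> set poly)
    (T : I -> set (set poly)) M : spec_family K m :=
  [set (F i, T i) | i in [set i | D i /\ F i <> radical (ideal_add M (F i))]].

Lemma diff_to_can_assoc N M (I : Type) (D : set I) (F : I -> set poly) T :
  diff_spec iota N M -> prime_decomposition D F (radical N) ->
  (forall i, D i -> prime_decomposition (T i) id (radical (ideal_add M (F i)))) ->
  assoc_can_spec iota (diff_set iota N M) (diff_to_can D F T M).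
Proof.
move=> NM DF DT; have [NI MI sNM _] := NM.
pose E := [set i | D i /\ F i <> radical (ideal_add M (F i))].
have ED : E `<=` D by move=> i [].
have FI i : D i -> is_ideal (F i).
  by case: DF => _ Fp _ _ /Fp /prime_idealI.
have TE i : D i -> \bigcap_(P in T i) P = radical (ideal_add M (F i)).
  by move=> /DT[].
have VT i : D i -> \bigcup_(P in T i) V P = V (F i) `&` V M.
  move=> Di; rewrite -(prime_decomposition_variety (DT i Di)) variety_radical.
  by rewrite variety_add //; [rewrite setIC|exact: FI].
split; last first.
  by exists N, M; split=> // _ [i [Di _] <-]; exact: TE.
split.
- by exists N, M.
- apply/seteqP; split=> [x [Nx Mx]|x [_ [i [Di _] <-] [Fx Tx]]]; last first.
    split; last by move=> Mx; apply: Tx; rewrite VT.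
    rewrite -variety_radical (prime_decomposition_variety DF).
    by exists i.
  move: Nx; rewrite -variety_radical (prime_decomposition_variety DF).
  move=> [i Di Fx]; exists (F i, T i); last first.
    by split=> //=; rewrite VT // => -[].
  (* Had the index been discarded, V(F i) would lie in V(M), which [x] avoids. *)
  exists i => //; split=> // Frad; apply: Mx.
  have : V (ideal_add M (F i)) x by rewrite -variety_radical -Frad.
  by rewrite variety_add //; [case|exact: FI].
- have {}DF := prime_decomposition_subset DF ED.
  have -> : \bigcap_(p in diff_to_can D F T M) p.1 = \bigcap_(i in E) F i.
    by rewrite bigcap_image.
  case: (DF) => Efin Ep _ irr; split.
  + exact: finite_image.
  + by move=> _ [i Ei <-]; exact: Ep.
  + by rewrite bigcap_image.
  (* Pairs with equal first ideals come from equal indices, so irredundancy passes from [F] to the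
     pairs. *)
  + move=> _ [i Ei <-] FE; apply: (irr i Ei); rewrite -FE.
    apply/seteqP; split=> f Ff.
      move=> _ [[j Ej <-] ji]; apply: Ff; split=> // ij; apply: ji.
      by rewrite ij.
    move=> j [Ej ji]; apply: (Ff (F j, T j)); split; first by exists j.
    by move=> /= -[/(prime_decomposition_inj DF Ej Ei)].
- by move=> _ [i [Di _] <-] /=; rewrite TE //; exact: DT.
- move=> _ [i [Di Fne] <-] P /= TP.
  have radP : radical (ideal_add M (F i)) `<=` P by rewrite -TE // => f; apply.
  have Frad : F i `<=` radical (ideal_add M (F i)).
    by apply: subset_trans (@sub_radical _ _); exact: ideal_addr.
  split; first exact: subset_trans radP.
  (* If [P] were inside [F i], then [F i] would be the radical of [M + F i] and its index
     discarded. *)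
  move=> PF; apply: Fne; apply/seteqP; split=> //.
  exact: subset_trans PF.
Qed.

Lemma exists_assoc_can_spec N M : diff_spec iota N M ->
  exists Y, assoc_can_spec iota (diff_set iota N M) Y.
Proof.
move=> NM; have [NI MI _ _] := NM.
have noeth := @noetherian_mpoly K m.
have [D DN] := exists_prime_decomposition noeth NI.
have /choice[T DT] P : exists T, D P ->
    prime_decomposition T id (radical (ideal_add M P)).
  (* Off [D] the value [set0] is arbitrary. *)
  have [DP|] := EM (D P); last by exists set0.
  have PI : is_ideal P by case: DN => _ Dp _ _; by apply: prime_idealI; apply: Dp.
  by have [T] := exists_prime_decomposition noeth (is_ideal_add MI PI); exists T.
exists (diff_to_can D id T M); exact: diff_to_can_assoc.
Qed.

(** The accumulating loop is a filter followed by a map, and concatenating lists of generators adds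
    the ideals. *)
Lemma diff_to_can_specE primedecomp eq_radical (gN gM : seq poly) :
  eq_radical_spec eq_radical ->
  output_family (diff_to_can_spec primedecomp eq_radical gN gM) =
  diff_to_can [set` primedecomp gN] (@ideal_gen poly)
    (fun s => [set ideal_gen t | t in [set` primedecomp (gM ++ s)]])
    (ideal_gen gM).
Proof.
move=> eqP'; rewrite /output_family /diff_to_can_spec.
pose step (Z : seq (seq poly * seq (seq poly))) (s : seq poly) :=
  if eq_radical s (gM ++ s) then Z else rcons Z (s, primedecomp (gM ++ s)).
have foldlE r Z : foldl step Z r =
  Z ++ [seq (s, primedecomp (gM ++ s)) | s <- r & ~~ eq_radical s (gM ++ s)].
  elim: r Z => [|s r IH] Z /=; first by rewrite cats0.
  by rewrite IH /step; case: ifP => //= _; rewrite cat_rcons.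
rewrite -/step foldlE cat0s.
apply/seteqP; split=> [_ [q /= /mapP[s sr ->] <-]|_ [s [/= ps sne] <-]].
  move: sr; rewrite mem_filter => /andP[/negP sne ps]; exists s => //; split=> //.
  by move=> E; apply: sne; apply/eqP'; rewrite ideal_gen_cat.
exists (s, primedecomp (gM ++ s)) => //=; apply/mapP; exists s => //.
rewrite mem_filter ps andbT; apply/negP => /eqP'.
by rewrite ideal_gen_cat.
Qed.

End Varieties.

Theorem theorem12 (K : fieldType) (K' : closedFieldType)
    (iota : {rmorphism K -> K'}) (m : nat) :
  (* 1 *)
  [/\ (forall N M : set {mpoly K[m]}, diff_spec iota N M ->
         (exists Y : spec_family K m, can_spec iota (diff_set iota N M) Y) /\
         (forall primedecomp eq_radical,
            primedecomp_spec primedecomp -> eq_radical_spec eq_radical ->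
          forall gN gM : seq {mpoly K[m]}, ideal_gen gN = N -> ideal_gen gM = M ->
            let Y := output_family
                       (diff_to_can_spec primedecomp eq_radical gN gM) in
            can_spec iota (diff_set iota N M) Y /\
            assoc_can_spec iota (diff_set iota N M) Y)),
  (* 2 *)
      (forall (C : set ('I_m -> K')) (Y : spec_family K m), can_spec iota C Y ->
         [/\ zariski_closure C
               = zariski_closure (\bigcup_(p in Y) (variety iota p.1 `\`
                                    \bigcup_(P in p.2) variety iota P)),
             zariski_closure (\bigcup_(p in Y) (variety iota p.1 `\`
                                \bigcup_(P in p.2) variety iota P))
               = \bigcup_(p in Y) variety iota p.1
           & \bigcup_(p in Y) variety iota p.1
               = variety iota (\bigcap_(p in Y) p.1)]),
  (* 3 *)
      (forall N M : set {mpoly K[m]}, diff_spec iota N M ->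
         exists! Y : spec_family K m, assoc_can_spec iota (diff_set iota N M) Y)
  (* 4 *)
    & (forall (C : set ('I_m -> K')) (Y : spec_family K m),
         assoc_can_spec iota C Y ->
         forall p, Y p ->
           C `&` variety iota p.1
             `<=` variety iota p.1 `\` \bigcup_(P in p.2) variety iota P)].
Proof.
split.
(* Existence comes from Noetherian decompositions, independently of the subroutines assumed for the
   algorithm. *)
- move=> N M NM; have [Y YC] := exists_assoc_can_spec NM.
  split; first by exists Y; case: YC.
  move=> primedecomp eq_radical pdP eqP' gN gM NE ME.
  suff Yassoc : assoc_can_spec iota (diff_set iota N M)
      (output_family (diff_to_can_spec primedecomp eq_radical gN gM)).
    by split=> //; case: Yassoc.
  rewrite diff_to_can_specE // ME; apply: diff_to_can_assoc => //.
    by rewrite -NE; exact: pdP.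
  move=> s _; rewrite -ME -ideal_gen_cat.
  exact: prime_decomposition_image (pdP _).
- move=> C Y YC; have [_ CE _ _ _] := YC.
  split; [by congr zariski_closure| |].
    by have := can_spec_closure YC; rewrite CE.
  exact: can_spec_variety YC.
- move=> N M NM; have [Y YC] := exists_assoc_can_spec NM.
  exists Y; split=> // Y' Y'C.
  apply/seteqP; split; first exact: assoc_can_spec_sub YC Y'C.
  exact: assoc_can_spec_sub Y'C YC.
- by move=> C Y YC p pY; exact: (assoc_can_spec_component YC pY).
Qed.
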